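(* Let $a,b\in\mathbb{R}$ with $0<a<b$ and let $n\in\mathbb{Z}$ with $|n(n-1)|\ge 3$. Then for all real $q\ge 1$, $$\left|\frac13A(a^n,b^n)+\frac23A^n(a,b)-L_n^n(a,b)\right|\le|n(n-1)|\,\frac{(b-a)^2}{162}\left(a^{q(n-2)}+b^{q(n-2)}\right)^{1/q}.$$
   Context: For positive reals $\alpha,\beta$, $A(\alpha,\beta)=\frac{\alpha+\beta}{2}$ is the arithmetic mean, and for positive reals $\alpha\ne\beta$ and $n\in\mathbb{Z}\setminus\{-1,0\}$, $L_n(\alpha,\beta)=\left[\frac{\beta^{n+1}-\alpha^{n+1}}{(n+1)(\beta-\alpha)}\right]^{1/n}$ is the generalized log-mean. $L_n^n(a,b)$ and $A^n(a,b)$ denote the $n$-th powers $(L_n(a,b))^n$ and $(A(a,b))^n$. *)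

(* Defs.v *)
From Stdlib Require Import Reals ZArith.
Open Scope R_scope.

Definition arith_mean (x y : R) : R := (x + y) / 2.

(* Meaningful for [0 < x], [0 < y], [x <> y] and [n] other than [-1] and [0];
   the bracket is then positive, so the real power [Rpower] is the genuine
   [n]-th root. Outside that domain the value carries no meaning. *)
Definition gen_log_mean (n : Z) (x y : R) : R :=
  Rpower ((powerRZ y (n + 1) - powerRZ x (n + 1)) / (IZR (n + 1) * (y - x)))
         (1 / IZR n).

(* Main.v *)
(** Write [w = b - a], [m] for the midpoint of [a, b] and [f x = x ^ n]. Two
    integrations by parts express the error of Simpson's rule as
    [w E = int_a^b K f''], where the Peano kernel is
    [K x = (x - a) (a + w / 3 - x) / 2] on [[a, m]], extended symmetrically
    about [m]. This kernel has integral zero, and its positive and negative parts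
    both have integral [w ^ 3 / 162]. As [0 <= f'' <= M] with
    [M = n (n - 1) max (a ^ (n - 2), b ^ (n - 2))], this yields
    [|E| <= M w ^ 2 / 162]; the maximum of two positive numbers is at most their
    [l^q] norm. *)
Require Import Defs.
From Stdlib Require Import Reals ZArith Lra Lia.
From Coquelicot Require Import Coquelicot.
Open Scope R_scope.

(* The middle expression is the increment of the antiderivative
   [k f' - k' f + k'' F] of [k f''], for [k x = s (x - u) (x - v) / 2]. *)
Lemma quadratic_kernel_bounds (F f f' f'' : R -> R) (s u v c d M : R) :
  c < d ->
  (forall x, c <= x <= d -> derivable_pt_lim F x (f x)) ->
  (forall x, c <= x <= d -> derivable_pt_lim f x (f' x)) ->
  (forall x, c <= x <= d -> derivable_pt_lim f' x (f'' x)) ->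
  (forall x, c <= x <= d -> 0 <= f'' x <= M) ->
  (forall x, c <= x <= d -> 0 <= s * ((x - u) * (x - v))) ->
  let P x := s * (x - u) * (x - v) / 2 * f' x
             - s * (2 * x - u - v) / 2 * f x + s * F x in
  let C x := s * (x ^ 3 / 3 - (u + v) * x ^ 2 / 2 + u * v * x) / 2 in
  0 <= P d - P c <= M * (C d - C c).
Proof.
intros Hcd HF Hf Hf' HM Hk P C.
assert (HP : forall x, c <= x <= d ->
  derivable_pt_lim P x (s * (x - u) * (x - v) / 2 * f'' x)).
{ intros x Hx; unfold P.
  assert (Hk1 : derivable_pt_lim (fun x => s * (x - u) * (x - v) / 2) x
                  (s * (2 * x - u - v) / 2)).
  { apply is_derive_Reals; auto_derive; [easy | field]. }
  assert (Hk2 : derivable_pt_lim (fun x => s * (2 * x - u - v) / 2) x s).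
  { apply is_derive_Reals; auto_derive; [easy | field]. }
  replace (s * (x - u) * (x - v) / 2 * f'' x) with
    ((s * (2 * x - u - v) / 2 * f' x + s * (x - u) * (x - v) / 2 * f'' x
      - (s * f x + s * (2 * x - u - v) / 2 * f' x)) + s * f x) by ring.
  apply (derivable_pt_lim_plus
    (fun x => s * (x - u) * (x - v) / 2 * f' x - s * (2 * x - u - v) / 2 * f x)
    (fun x => s * F x)).
  - apply (derivable_pt_lim_minus
      (fun x => s * (x - u) * (x - v) / 2 * f' x)
      (fun x => s * (2 * x - u - v) / 2 * f x)).
    + exact (derivable_pt_lim_mult _ _ _ _ _ Hk1 (Hf' x Hx)).
    + exact (derivable_pt_lim_mult _ _ _ _ _ Hk2 (Hf x Hx)).
  - exact (derivable_pt_lim_scal _ _ _ _ (HF x Hx)). }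
assert (HC : forall x, c <= x <= d ->
  derivable_pt_lim C x (s * (x - u) * (x - v) / 2)).
{ intros x _; unfold C; apply is_derive_Reals; auto_derive; [easy | field]. }
split.
- destruct (MVT_cor2 P _ c d Hcd HP) as [x [-> Hx]].
  specialize (HM x ltac:(lra)); specialize (Hk x ltac:(lra)).
  apply Rmult_le_pos; [| lra].
  apply Rmult_le_pos; [nra | lra].
(* As [C] is an antiderivative of the kernel [k], [M * C - P] has derivative [k * (M - f'')], which
   is nonnegative. *)
- assert (HD : forall x, c <= x <= d ->
    derivable_pt_lim (fun x => M * C x - P x) x
      (M * (s * (x - u) * (x - v) / 2) - s * (x - u) * (x - v) / 2 * f'' x)).
  { intros x Hx.
    apply (derivable_pt_lim_minus (fun x => M * C x) P); [| exact (HP x Hx)].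
    exact (derivable_pt_lim_scal _ _ _ _ (HC x Hx)). }
  destruct (MVT_cor2 _ _ c d Hcd HD) as [x [Heq Hx]].
  specialize (HM x ltac:(lra)); specialize (Hk x ltac:(lra)).
  enough (0 <= M * (s * (x - u) * (x - v) / 2)
               - s * (x - u) * (x - v) / 2 * f'' x) by nra.
  replace (_ - _) with (s * ((x - u) * (x - v)) / 2 * (M - f'' x)) by field.
  apply Rmult_le_pos; lra.
Qed.

Lemma simpson_error_bound (F f f' f'' : R -> R) (a b M : R) :
  a < b ->
  (forall x, a <= x <= b -> derivable_pt_lim F x (f x)) ->
  (forall x, a <= x <= b -> derivable_pt_lim f x (f' x)) ->
  (forall x, a <= x <= b -> derivable_pt_lim f' x (f'' x)) ->
  (forall x, a <= x <= b -> 0 <= f'' x <= M) ->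
  Rabs (1 / 3 * ((f a + f b) / 2) + 2 / 3 * f ((a + b) / 2)
        - (F b - F a) / (b - a)) <= M * ((b - a) ^ 2 / 162).
Proof.
intros Hab HF Hf Hf' HM.
assert (Hpiece : forall s u v c d, a <= c -> c < d -> d <= b ->
  (forall x, c <= x <= d -> 0 <= s * ((x - u) * (x - v))) -> _)
  by (intros s u v c d Hac Hcd Hdb;
      apply (quadratic_kernel_bounds F f f' f'' s u v c d M Hcd);
      intros x Hx; [apply HF | apply Hf | apply Hf' | apply HM]; lra).
cbv beta zeta in Hpiece.
(* The Peano kernel changes sign exactly at [p] and [r]. On each of the four pieces, [s] is chosen
   so that the integrand is its absolute value. *)
set (p := a + (b - a) / 3); set (r := b - (b - a) / 3); set (m := (a + b) / 2).
assert (H1 := Hpiece (-1) a p a p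
  ltac:(unfold p; lra) ltac:(unfold p; lra) ltac:(unfold p; lra)
  ltac:(unfold p; intros; nra)).
assert (H2 := Hpiece 1 a p p m
  ltac:(unfold p; lra) ltac:(unfold p, m; lra) ltac:(unfold m; lra)
  ltac:(unfold p, m; intros; nra)).
assert (H3 := Hpiece 1 b r m r
  ltac:(unfold m; lra) ltac:(unfold r, m; lra) ltac:(unfold r; lra)
  ltac:(unfold r, m; intros; nra)).
assert (H4 := Hpiece (-1) b r r b
  ltac:(unfold r; lra) ltac:(unfold r; lra) ltac:(lra)
  ltac:(unfold r; intros; nra)).
clear Hpiece.
set (E := _ - (F b - F a) / (b - a)).
assert (HE : (b - a) * E =
  (b - a) * (1 / 3 * ((f a + f b) / 2) + 2 / 3 * f m) - (F b - F a)).
{ unfold E, m; field; lra. }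
(* The absolute value of the kernel has the same integral, [(b - a) ^ 3 / 324], over all four
   pieces. *)
match type of H1 with 0 <= ?x <= ?y => set (I1 := x) in *;
  replace y with (M * ((b - a) ^ 3 / 324)) in H1 by (unfold p; field) end.
match type of H2 with 0 <= ?x <= ?y => set (I2 := x) in *;
  replace y with (M * ((b - a) ^ 3 / 324)) in H2 by (unfold p, m; field) end.
match type of H3 with 0 <= ?x <= ?y => set (I3 := x) in *;
  replace y with (M * ((b - a) ^ 3 / 324)) in H3 by (unfold r, m; field) end.
match type of H4 with 0 <= ?x <= ?y => set (I4 := x) in *;
  replace y with (M * ((b - a) ^ 3 / 324)) in H4 by (unfold r; field) end.
(* The boundary terms at [p] and [r] cancel. At [m] the kernel is continuous, so [f' m] drops out,
   but its slope jumps, which produces the weight 2/3 of [f m]. *)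
assert (HI : (b - a) * E = I1 - I2 - I3 + I4).
{ rewrite HE; unfold I1, I2, I3, I4.
  generalize (f a) (f b) (f m) (f p) (f r) (f' a) (f' b) (f' m) (f' p) (f' r)
    (F a) (F b) (F m) (F p) (F r); intros.
  unfold p, r, m; field. }
apply (Rmult_le_reg_l (b - a)); [lra |].
rewrite <- (Rabs_pos_eq (b - a)) at 1 by lra.
rewrite <- Rabs_mult.
replace ((b - a) * (M * ((b - a) ^ 2 / 162)))
  with (2 * (M * ((b - a) ^ 3 / 324))) by field.
(* [I1 + I4] and [I2 + I3] lie in the same interval starting at 0, so their difference is bounded by
   its length, half of what adding the four bounds would give. *)
rewrite HI; apply Rabs_le; lra.
Qed.

(** The power is monotone in its base, in a direction set by the sign of [p], so its maximum is at
    an endpoint. *)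
Lemma Rpower_le_Rmax (a b x p : R) :
  0 < a -> a <= x <= b -> Rpower x p <= Rmax (Rpower a p) (Rpower b p).
Proof.
intros Ha Hx; unfold Rpower.
assert (Hmono : forall y z, y <= z -> exp y <= exp z).
{ intros y z [H | ->]; [left; now apply exp_increasing | apply Rle_refl]. }
assert (ln a <= ln x) by (apply ln_le; lra).
assert (ln x <= ln b) by (apply ln_le; lra).
destruct (Rle_dec 0 p).
- apply Rle_trans with (2 := Rmax_r _ _); apply Hmono; nra.
- apply Rle_trans with (2 := Rmax_l _ _); apply Hmono; nra.
Qed.

(** Each [z] is the [q]-th root of its own [q]-th power, and adding a positive term under the root
    only increases it. *)
Lemma Rmax_le_lq_norm (x y q : R) :
  0 < q -> 0 < x -> 0 < y ->
  Rmax x y <= Rpower (Rpower x q + Rpower y q) (1 / q).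
Proof.
intros Hq Hx Hy.
assert (Hx' : 0 < Rpower x q) by apply exp_pos.
assert (Hy' : 0 < Rpower y q) by apply exp_pos.
assert (H0 : 0 <= 1 / q) by (apply Rlt_le, Rdiv_lt_0_compat; lra).
assert (Hroot : forall z, 0 < z -> z = Rpower (Rpower z q) (1 / q)).
{ intros z Hz; rewrite Rpower_mult.
  replace (q * (1 / q)) with 1 by (field; lra).
  now rewrite Rpower_1. }
apply Rmax_lub.
- rewrite (Hroot x Hx) at 1; apply Rle_Rpower_l; lra.
- rewrite (Hroot y Hy) at 1; apply Rle_Rpower_l; lra.
Qed.

Lemma Rpower_simpson_error_bound (a b p : R) :
  0 < a -> a < b -> p + 1 <> 0 -> 0 <= p * (p - 1) ->
  Rabs (1 / 3 * ((Rpower a p + Rpower b p) / 2)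
        + 2 / 3 * Rpower ((a + b) / 2) p
        - (Rpower b (p + 1) - Rpower a (p + 1)) / ((p + 1) * (b - a)))
  <= p * (p - 1) * Rmax (Rpower a (p - 2)) (Rpower b (p - 2))
     * ((b - a) ^ 2 / 162).
Proof.
intros Ha Hab Hp Hpp.
replace ((Rpower b (p + 1) - Rpower a (p + 1)) / ((p + 1) * (b - a)))
  with ((/ (p + 1) * Rpower b (p + 1) - / (p + 1) * Rpower a (p + 1)) / (b - a))
  by (field; lra).
apply (simpson_error_bound (fun x => / (p + 1) * Rpower x (p + 1))
  (fun x => Rpower x p) (fun x => p * Rpower x (p - 1))
  (fun x => p * (p - 1) * Rpower x (p - 2)) a b _ Hab); intros x Hx.
- replace (Rpower x p) with (/ (p + 1) * ((p + 1) * Rpower x (p + 1 - 1))).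
  + apply (derivable_pt_lim_scal (fun x => Rpower x (p + 1))).
    apply derivable_pt_lim_power; lra.
  + replace (p + 1 - 1) with p by ring; field; lra.
- apply derivable_pt_lim_power; lra.
- rewrite Rmult_assoc.
  apply (derivable_pt_lim_scal (fun x => Rpower x (p - 1))).
  replace (p - 2) with (p - 1 - 1) by ring.
  apply derivable_pt_lim_power; lra.
- split.
  + apply Rmult_le_pos; [easy | apply Rlt_le, exp_pos].
  + apply Rmult_le_compat_l; [easy |].
    now apply Rpower_le_Rmax.
Qed.

(** By the mean value theorem the quotient is a value of [x ^ (p - 1)]. Positivity is what lets the
    [n]-th power undo the root in [gen_log_mean]. *)
Lemma Rpower_increment_quotient_pos (a b p : R) :
  0 < a -> a < b -> p <> 0 ->
  0 < (Rpower b p - Rpower a p) / (p * (b - a)).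
Proof.
intros Ha Hab Hp.
destruct (MVT_cor2 (fun x => Rpower x p) (fun x => p * Rpower x (p - 1)) a b Hab)
  as [x [-> _]].
- intros x Hx; apply derivable_pt_lim_power; lra.
- replace (_ / _) with (Rpower x (p - 1)) by (field; lra).
  apply exp_pos.
Qed.

Lemma powerRZ_gen_log_mean (n : Z) (a b : R) :
  0 < a -> a < b -> n <> 0%Z -> (n + 1 <> 0)%Z ->
  powerRZ (gen_log_mean n a b) n
  = (Rpower b (IZR n + 1) - Rpower a (IZR n + 1)) / ((IZR n + 1) * (b - a)).
Proof.
intros Ha Hab Hn Hn1.
apply not_0_IZR in Hn; apply not_0_IZR in Hn1; rewrite plus_IZR in Hn1.
unfold gen_log_mean.
rewrite powerRZ_Rpower by apply exp_pos.
rewrite !powerRZ_Rpower by lra.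
rewrite Rpower_mult, plus_IZR.
replace (1 / IZR n * IZR n) with 1 by (field; assumption).
apply Rpower_1.
now apply Rpower_increment_quotient_pos.
Qed.

Theorem proposition3 (a b : R) (n : Z) (ha : 0 < a) (hab : a < b)
    (hn : (3 <= Z.abs (n * (n - 1)))%Z) :
  forall q : R, 1 <= q ->
    Rabs (1 / 3 * arith_mean (powerRZ a n) (powerRZ b n)
          + 2 / 3 * powerRZ (arith_mean a b) n
          - powerRZ (gen_log_mean n a b) n)
    <= Rabs (IZR (n * (n - 1))) * ((b - a) ^ 2 / 162)
       * Rpower (Rpower a (q * IZR (n - 2)) + Rpower b (q * IZR (n - 2))) (1 / q).
Proof.
intros q Hq.
(* At [n = 0] and [n = -1] the product [n * (n - 1)] is 0 and 2, both below 3. *)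
assert (Hn0 : n <> 0%Z) by (intros ->; simpl in hn; lia).
assert (Hn1 : (n + 1 <> 0)%Z).
{ intros H; replace n with (-1)%Z in hn by lia; simpl in hn; lia. }
(* A product of two consecutive integers is never negative, so [x ^ n] is convex on the positive
   reals. *)
assert (Hpos : 0 <= IZR n * (IZR n - 1)).
{ rewrite <- minus_IZR, <- mult_IZR; apply IZR_le; nia. }
rewrite powerRZ_gen_log_mean by assumption.
unfold arith_mean; rewrite !powerRZ_Rpower by lra.
rewrite mult_IZR, !minus_IZR, (Rabs_pos_eq _ Hpos).
apply Rle_trans with (1 := Rpower_simpson_error_bound a b (IZR n) ha hab
  ltac:(rewrite <- plus_IZR; now apply not_0_IZR) Hpos).
rewrite Rmult_assoc, (Rmult_comm (Rmax _ _)), <- Rmult_assoc.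
apply Rmult_le_compat_l.
- apply Rmult_le_pos; [easy |].
  apply Rmult_le_pos; [apply pow2_ge_0 | lra].
- rewrite !(Rmult_comm q), <- !Rpower_mult.
  apply Rmax_le_lq_norm; [lra | apply exp_pos | apply exp_pos].
Qed.
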